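(* A Markovian coupling $(\bar X_t,\bar Y_t)$ of the random transposition walk on $S_n$ takes at least $\Omega(n^2)$ time to meet.
   Context: The random transposition walk on $S_n$ is the Markov chain in which, at each step, two elements $u,v\in\{1,\dots,n\}$ are chosen independently and uniformly at random and the current permutation is multiplied by the transposition $(u\,v)$ (by the identity if $u=v$); let $\bar P$ be its transition matrix. A Markovian coupling of this walk is a Markov chain $(\bar X_t,\bar Y_t)_{t\ge0}$ on $S_n\times S_n$ such that, conditionally on $(\bar X_t,\bar Y_t)=(\alpha,\alpha')$ and on the past, $\bar X_{t+1}$ has law $\bar P(\alpha,\cdot)$ and $\bar Y_{t+1}$ has law $\bar P(\alpha',\cdot)$. The two walks start at different permutations, and they meet at the first time $t$ with $\bar X_t=\bar Y_t$. $\Omega(n^2)$ denotes a quantity bounded below by a positive constant times $n^2$. *)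

(* Defs.v *)
From HB Require Import structures.
From mathcomp Require Import all_boot all_order all_algebra all_fingroup.
From mathcomp Require Import all_classical all_reals all_analysis.
Set Implicit Arguments.
Unset Strict Implicit.
Unset Printing Implicit Defensive.
Import Order.TTheory GRing.Theory Num.Theory.
Local Open Scope classical_set_scope.
Local Open Scope ring_scope.

(* Transition matrix of the random transposition walk: the number of ordered
   pairs (u, v), out of n ^ 2, that lead from a to b. When u = v,
   [tperm u v] is the identity. Permutations multiply on the right,
   (a * tperm u v) i = tperm u v (a i). *)
Definition rand_transp (R : realType) (n : nat) (a b : 'S_n) : R :=
  #|[pred uv : 'I_n * 'I_n | b == (a * tperm uv.1 uv.2)%g]|%:R / (n ^ 2)%:R.

(* Junk value 0 when P B = 0; only used below under P B != 0. *)
Definition cond_pr (R : realType) (d : measure_display)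
    (T : measurableType d) (P : probability T R) (A B : set T) : R :=
  fine (P (A `&` B)) / fine (P B).

Definition history (T S : Type) (Z : nat -> T -> S) (t : nat) (z : nat -> S) :
    set T :=
  [set w | forall i, (i <= t)%N -> Z i w = z i].

(* The finite state space S carries its discrete sigma-algebra, so Z t is
   measurable as soon as its level sets are. Transition probabilities are
   allowed to depend on time. *)
Definition markov_chain (R : realType) (d : measure_display)
    (T : measurableType d) (P : probability T R) (S : finType)
    (Z : nat -> T -> S) : Prop :=
  (forall t s, measurable (Z t @^-1` [set s])) /\
  (forall t (z : nat -> S) s, P (history Z t z) != 0%E ->
     cond_pr P (Z t.+1 @^-1` [set s]) (history Z t z) =
     cond_pr P (Z t.+1 @^-1` [set s]) (Z t @^-1` [set z t])).

Definition markovian_coupling (R : realType) (d : measure_display)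
    (T : measurableType d) (P : probability T R) (n : nat)
    (X Y : nat -> T -> 'S_n) : Prop :=
  let Z := fun t w => (X t w, Y t w) in
  markov_chain P Z /\
  (forall t (z : nat -> 'S_n * 'S_n), P (history Z t z) != 0%E ->
     (forall b, cond_pr P (X t.+1 @^-1` [set b]) (history Z t z) =
                rand_transp R (z t).1 b) /\
     (forall b, cond_pr P (Y t.+1 @^-1` [set b]) (history Z t z) =
                rand_transp R (z t).2 b)).

(* Equal to +oo on paths that never meet. *)
Definition meeting_time (R : realType) (T S : Type) (X Y : nat -> T -> S)
    (w : T) : \bar R :=
  ereal_inf [set (t%:R)%:E | t in [set t : nat | X t w = Y t w]].

(* Main.v *)
(* Given the history up to time t, with the walks at distinct states a and b,
   the probability of meeting at time t + 1 is at most the overlap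
   sum_c min(p(a, c), p(b, c)) of the one-step laws, whatever the coupling. At
   most 5 permutations c are reachable from both a and b, because a product of
   two transpositions that moves a given point i has essentially three
   factorisations; since c <> a or c <> b, each has overlap at most 2 / n ^ 2. A
   union bound over the first c n ^ 2 steps gives P(T < c n ^ 2) <= 10 c, and
   Markov's inequality then gives E T >= n ^ 2 / 40. *)
Require Import Defs.
From HB Require Import structures.
From mathcomp Require Import all_boot all_order all_algebra all_fingroup.
From mathcomp Require Import all_classical all_reals all_analysis.
From mathcomp Require Import measurable_realfun lra.
Set Implicit Arguments.
Unset Strict Implicit.
Unset Printing Implicit Defensive.
Import Order.TTheory GRing.Theory Num.Theory.
Local Open Scope classical_set_scope.
Local Open Scope ring_scope.

(** * Transpositions and the overlap of one-step laws *)

Lemma tpermK_perm (n : nat) (a : 'S_n) (u v : 'I_n) :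
  (a * tperm u v * tperm u v)%g = a.
Proof. by rewrite -mulgA tperm2 mulg1. Qed.

Lemma tperm_eqP (T : finType) (u v x y : T) : u != v ->
  tperm x y = tperm u v -> (x, y) \in [:: (u, v); (v, u)].
Proof.
move=> uv e; have := tpermL x y; rewrite e !inE !xpair_eqE.
case: tpermP => [->|->|/eqP xu /eqP xv xy]; try by move=> ->; rewrite !eqxx ?orbT.
move: e uv; rewrite -xy tperm1 => /(congr1 (fun s : {perm T} => s u)).
by rewrite tpermL perm1 => ->; rewrite eqxx.
Qed.

Definition transp_count (n : nat) (a b : 'S_n) : nat :=
  #|[pred uv : 'I_n * 'I_n | b == (a * tperm uv.1 uv.2)%g]|.

(** If [b] is reached at all, [a^-1 * b] is a transposition, which determines its pair up to
    order. *)
Lemma transp_count_le2 (n : nat) (a b : 'S_n) :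
  a != b -> (transp_count a b <= 2)%N.
Proof.
move=> ab; rewrite /transp_count.
case: (pickP [pred uv : 'I_n * 'I_n | b == (a * tperm uv.1 uv.2)%g]) =>
  [[u v] /= /eqP buv|none]; last first.
  by rewrite (eq_card none) card0.
apply: leq_trans (card_size [:: (u, v); (v, u)]).
apply/subset_leq_card/fintype.subsetP => -[x y]; rewrite inE /= buv => /eqP/mulgI e.
apply: tperm_eqP => //; apply: contraNneq ab => uv.
by rewrite buv uv tperm1 mulg1.
Qed.

(** Meeting at [c] factors [s] into two transpositions, and following the moved point [i] through
    them pins one factor down. If the first fixes [i], the second is [tperm i (s i)]. If the first
    sends [i] to [k != i] and the second fixes [k], the first is [tperm i (s i)]. Otherwise
    [s k = i]. *)
Lemma transp_meeting_point (n : nat) (a b c : 'S_n) (i : 'I_n) :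
  let s := (a^-1 * b)%g in
  s i != i ->
  (0 < transp_count a c)%N -> (0 < transp_count b c)%N ->
  c \in [:: a; b; (a * tperm i (s i))%g; (b * tperm i (s i))%g;
            (a * tperm i ((s^-1)%g i))%g].
Proof.
move=> s si /card_gt0P[[u v]]; rewrite inE /= => /eqP cuv /card_gt0P[[x y]].
rewrite inE /= => /eqP cxy.
have es : s = (tperm u v * tperm x y)%g.
  apply: (mulgI a); apply: (mulIg (tperm x y)).
  by rewrite /s mulgA mulgV mul1g -cxy cuv !mulgA tpermK_perm.
have esi : s i = tperm x y (tperm u v i) by rewrite es permM.
have [tu|tu] := eqVneq (tperm u v i) i.
  suff -> : tperm i (s i) = tperm x y by rewrite cxy !inE eqxx !orbT.
  rewrite esi tu; rewrite esi tu in si; move: si.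
  by case: tpermP => [->|->|]; rewrite ?eqxx // tpermC.
have tuv : tperm u v = tperm i (tperm u v i).
  by move: tu; case: tpermP => [->|->|]; rewrite ?eqxx // tpermC.
move: tuv esi; set k := tperm u v i => tuv esi.
have [tx|tx] := eqVneq (tperm x y k) k.
  have -> : tperm i (s i) = tperm u v by rewrite esi tx tuv.
  by rewrite cuv !inE eqxx !orbT.
(* The second factor moves [k]; if it also moved [i], it would swap them and [s] would fix [i]. So
   it fixes [i], whence [s k = i]. *)
suff -> : (s^-1)%g i = k by rewrite -tuv cuv !inE eqxx !orbT.
apply: (canLR (permK s)); rewrite es permM tuv tpermR.
apply/eqP; rewrite eq_sym; apply: contraNT tx => ni.
move: si ni; rewrite esi; move: tu; rewrite -/k.
by case: (tpermP x y k) => [->|->|]; case: (tpermP x y i) => [->|->|];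
  rewrite ?eqxx.
Qed.

Lemma transp_overlap (n : nat) (a b : 'S_n) : a != b ->
  (\sum_c minn (transp_count a c) (transp_count b c) <= 10)%N.
Proof.
move=> ab; have [i si] : exists i, (a^-1 * b)%g i != i.
  apply/existsP; rewrite -negb_forall; apply: contraNN ab => /forallP id.
  apply/eqP; apply: (mulgI a^-1%g); rewrite mulVg; apply/permP => i.
  by rewrite perm1; apply/esym/eqP.
pose s := (a^-1 * b)%g.
pose l := [:: a; b; (a * tperm i (s i))%g; (b * tperm i (s i))%g;
            (a * tperm i ((s^-1)%g i))%g].
have le2 c : (minn (transp_count a c) (transp_count b c) <= 2)%N.
  rewrite geq_min; have [<-|ac] := eqVneq a c.
    by rewrite [X in _ || X]transp_count_le2 ?orbT // eq_sym.
  by rewrite transp_count_le2.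
apply: (@leq_trans (\sum_(c in l) 2)); last first.
  by rewrite sum_nat_const (leq_mul2r 2 _ 5) /=; exact: card_size.
(* Outside [l] one of the two counts vanishes, so the minimum is 0. *)
rewrite [leqRHS]big_mkcond; apply: leq_sum => c _.
case: ifPn => // /negP cl; rewrite leqNgt leq_min.
by apply/andP => -[? ?]; apply: cl; exact: transp_meeting_point.
Qed.

Lemma rand_transp_overlap (R : realType) (n : nat) (a b : 'S_n) : a != b ->
  \sum_c Num.min (rand_transp R a c) (rand_transp R b c) <= 10 / (n ^ 2)%:R.
Proof.
move=> ab; have := transp_overlap ab.
rewrite -(ler_nat R) natr_sum => /(ler_wpM2r (x := (n ^ 2)%:R^-1)).
rewrite invr_ge0 ler0n mulr_suml => /(_ isT); apply: le_trans.
apply: ler_sum => c _.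
rewrite /rand_transp -/(transp_count a c) -/(transp_count b c).
by rewrite /minn; case: ltnP => _; rewrite ge_min lexx ?orbT.
Qed.

(** * Probabilities of finite families of events *)

Section finite_families.
Local Open Scope ereal_scope.
Context (d : measure_display) (T : measurableType d) (R : realType).

Lemma measure_finU_le (mu : measure T R) (I : Type) (r : seq I) (F : I -> set T) :
  (forall i, measurable (F i)) ->
  mu (\big[setU/set0]_(i <- r) F i) <= \sum_(i <- r) mu (F i).
Proof.
move=> mF; elim: r => [|i r ih]; first by rewrite !big_nil measure0.
rewrite !big_cons; apply: (le_trans (measureU2 _ _ _)) => //.
- exact: bigsetU_measurable.
- exact: leeD2l.
Qed.

Lemma mem_bigsetU_fin (I : finType) (F : I -> set T) (w : T) :
  (\big[setU/set0]_i F i) w <-> exists i, F i w.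
Proof.
rewrite -bigcup_seq; split=> [[i _ ?]|[i ?]]; exists i => //=.
exact: mem_index_enum.
Qed.

Lemma probability_sum_le1 (P : probability T R) (I : finType) (F : I -> set T) :
  (forall i, measurable (F i)) -> trivIset setT F -> \sum_i P (F i) <= 1.
Proof.
move=> mF tF; rewrite fsbig_seq ?index_enum_uniq //.
rewrite -measure_fin_bigcup //; last exact: sub_trivIset tF.
by apply: probability_le1; apply: fin_bigcup_measurable.
Qed.

(** Each triple intersection lies in both [A c] and [B c] within [E], so its mass is at most the
    smaller of the two. Only the marginal laws [p] and [q] enter, which makes the bound valid for
    every coupling. *)
Lemma measure_coincidence_le (P : probability T R) (S : finType) (A B : S -> set T)
    (E : set T) (p q : S -> R) :
  (forall c, measurable (A c)) -> (forall c, measurable (B c)) ->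
  measurable E ->
  (forall c, P (A c `&` E) = (p c)%:E * P E) ->
  (forall c, P (B c `&` E) = (q c)%:E * P E) ->
  P (\big[setU/set0]_c (A c `&` B c `&` E)) <=
    (\sum_c Num.min (p c) (q c))%R%:E * P E.
Proof.
move=> mA mB mE hA hB.
have mABE c : measurable (A c `&` B c `&` E) by do 2![apply: measurableI => //].
apply: (le_trans (measure_finU_le _ _ mABE)).
have /fineK PE : P E \is a fin_num by exact: fin_num_measure.
rewrite -PE -EFinM mulr_suml -sumEFin; apply: lee_sum => c _.
rewrite /Num.min; case: ifP => _; rewrite EFinM PE -?hA -?hB.
- by apply: le_measure; rewrite ?inE //; [exact: measurableI|move=> w [[]]].
- by apply: le_measure; rewrite ?inE //; [exact: measurableI|move=> w [[]]].
Qed.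

End finite_families.

(** The product form also holds on null events, where both sides vanish; histories of probability 0
    then need no separate treatment. *)
Lemma cond_prE (R : realType) (d : measure_display) (T : measurableType d)
    (P : probability T R) (A B : set T) (p : R) :
  measurable A -> measurable B -> (P B != 0%E -> cond_pr P A B = p) ->
  P (A `&` B) = (p%:E * P B)%E.
Proof.
move=> mA mB; have mAB := measurableI _ _ mA mB.
have [PB0 _|PB0 /(_ isT) <-] := eqVneq (P B) 0%E.
  rewrite PB0 mule0; apply/eqP; rewrite eq_le measure_ge0 andbT -PB0.
  by apply: le_measure; rewrite ?inE // => w [].
have fA : P (A `&` B) \is a fin_num by exact: fin_num_measure.
have fB : P B \is a fin_num by exact: fin_num_measure.
by rewrite /cond_pr -{2}(fineK fB) -EFinM divfK ?fineK // fine_eq0.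
Qed.

(** * Probability of meeting at a given step *)

Section coupling.
Context (R : realType) (d : measure_display) (T : measurableType d).
Context (P : probability T R) (n : nat) (X Y : nat -> T -> 'S_n).
Context (XY : markovian_coupling P X Y).

Let Z := fun t w => (X t w, Y t w).

Let mZ t s : measurable (Z t @^-1` [set s]).
Proof. exact: (proj1 XY).1. Qed.

Lemma coupling_measurable_event t (Q : 'S_n -> 'S_n -> Prop) :
  measurable [set w | Q (X t w) (Y t w)].
Proof.
rewrite (_ : mkset _ = \bigcup_(s in [set s | Q s.1 s.2]) Z t @^-1` [set s]).
  by apply: fin_bigcup_measurable => //; exact: finite_finset.
apply/seteqP; split => [w Qw|w [s Qs] /= Es].
  by exists (Z t w).
by move: Qs; rewrite /= -Es.
Qed.

(** Paths up to time [t] are encoded as finite functions, so that there are finitely many of them to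
    sum over. [inord] extends a path to all of [nat], but [history] only reads indices up to [t]. *)
Let path_history t (f : {ffun 'I_t.+1 -> 'S_n * 'S_n}) : set T :=
  history Z t (f \o inord).

Let measurable_path_history t (f : {ffun 'I_t.+1 -> 'S_n * 'S_n}) :
  measurable (path_history f).
Proof.
rewrite (_ : path_history f = \bigcap_(i in `I_t.+1) Z i @^-1` [set f (inord i)]).
  by apply: bigcap_measurableType => // i _; exact: mZ.
by apply/seteqP; split.
Qed.

Let trivIset_path_history t : trivIset setT (@path_history t).
Proof.
move=> f g _ _ [w [fw gw]]; apply/ffunP => i.
have it : (i <= t)%N by rewrite -ltnS.
by have := fw _ it; rewrite (gw _ it) /= inord_val.
Qed.

(** Split according to the path up to [t]. Each path ending in distinct states contributes at most
    the overlap bound times its probability, and these probabilities sum to at most 1 by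
    disjointness. *)
Lemma meeting_step_le t :
  (P [set w | X t w <> Y t w /\ X t.+1 w = Y t.+1 w] <=
    (10 / (n ^ 2)%:R)%:E)%E.
Proof.
pose E f := path_history (t := t) f.
pose sep (f : {ffun 'I_t.+1 -> 'S_n * 'S_n}) := (f ord_max).1 != (f ord_max).2.
pose M f := if sep f then \big[setU/set0]_c
  (X t.+1 @^-1` [set c] `&` Y t.+1 @^-1` [set c] `&` E f) else set0.
have mX b : measurable (X t.+1 @^-1` [set b]).
  exact: (coupling_measurable_event t.+1 (fun x _ => x = b)).
have mY b : measurable (Y t.+1 @^-1` [set b]).
  exact: (coupling_measurable_event t.+1 (fun _ y => y = b)).
have mE f : measurable (E f) by exact: measurable_path_history.
have mM f : measurable (M f).
  rewrite /M; case: ifP => // _; apply: bigsetU_measurable => c _.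
  by do 2![apply: measurableI => //].
have PM f : (P (M f) <= (10 / (n ^ 2)%:R)%:E * P (E f))%E.
  rewrite /M; case: ifPn => [sf|_]; last first.
    by rewrite measure0 mule_ge0 // lee_fin divr_ge0.
  have zt : (f \o inord) t = f ord_max.
    by rewrite /= -[t in inord t]/(val (@ord_max t)) inord_val.
  pose p c := rand_transp R (f ord_max).1 c.
  pose q c := rand_transp R (f ord_max).2 c.
  apply: (le_trans (measure_coincidence_le (p := p) (q := q) mX mY (mE f) _ _)).
  - move=> c; apply: cond_prE => // /(proj2 XY t (f \o inord)) [h _].
    by rewrite h zt.
  - move=> c; apply: cond_prE => // /(proj2 XY t (f \o inord)) [_ h].
    by rewrite h zt.
  - by apply: lee_wpmul2r => //; rewrite lee_fin rand_transp_overlap.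
apply: (@le_trans _ _ (P (\big[setU/set0]_f M f))).
  apply: le_measure; rewrite ?inE.
  - apply: (measurableI _ _ (coupling_measurable_event t (fun x y => x <> y))).
    exact: (coupling_measurable_event t.+1 (fun x y => x = y)).
  - exact: bigsetU_measurable.
  move=> w [nXY eXY]; apply/mem_bigsetU_fin.
  (* The piece containing [w] is indexed by its own trajectory. *)
  exists [ffun i : 'I_t.+1 => Z i w]; rewrite /M /sep ffunE /=.
  case: ifPn => [_|/negPn/eqP //]; apply/mem_bigsetU_fin.
  exists (X t.+1 w); split => //; move=> i it /=.
  by rewrite ffunE inordK // ltnS.
apply: (le_trans (measure_finU_le _ _ mM)).
apply: (@le_trans _ _ ((10 / (n ^ 2)%:R)%:E * \sum_f P (E f))%E).
  by rewrite ge0_sume_distrr //; apply: lee_sum => f _; exact: PM.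
rewrite -[leRHS]mule1; apply: lee_wpmul2l; first by rewrite lee_fin divr_ge0.
apply: probability_sum_le1 => //; exact: trivIset_path_history.
Qed.

(** * The meeting time as a random variable *)

Lemma meeting_time_lt (w : T) (r : R) :
  (meeting_time R X Y w < r%:E)%E <-> exists2 t, t%:R < r & X t w = Y t w.
Proof.
split=> [/ereal_inf_lt [_ [t XYt <-]]|[t tr XYt]].
  by rewrite lte_fin => tr; exists t.
apply: (@le_lt_trans _ _ (t%:R)%:E); last by rewrite lte_fin.
by apply: ereal_inf_lbound; exists t.
Qed.

Lemma measurable_meeting_time_lt (r : R) :
  measurable [set w | (meeting_time R X Y w < r%:E)%E].
Proof.
rewrite (_ : mkset _ = \bigcup_(t in [set t | t%:R < r]) [set w | X t w = Y t w]).
  by apply: bigcup_measurable => t _; exact: (coupling_measurable_event t eq).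
apply/seteqP; split => w /=.
  by move/meeting_time_lt => [t tr XYt]; exists t.
by move=> [t tr XYt]; apply/meeting_time_lt; exists t.
Qed.

Lemma measurable_meeting_time : measurable_fun setT (meeting_time R X Y).
Proof.
apply: (measurability _ (ErealGenInftyO.measurableE R)) => _ [_ [r ->] <-].
rewrite setTI (_ : _ @^-1` _ = [set w | (meeting_time R X Y w < r%:E)%E]).
  exact: measurable_meeting_time_lt.
by apply/seteqP; split => w /=; rewrite in_itv.
Qed.

Lemma meeting_time_ge0 (w : T) : (0 <= meeting_time R X Y w)%E.
Proof. by apply: le_ereal_inf_tmp => _ [t _ <-]; rewrite lee_fin. Qed.

(** * Lower bounds in probability and in expectation *)

Context (start : {ae P, forall w, X 0%N w <> Y 0%N w}).

Lemma early_meeting_le (c : R) : 0 <= c ->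
  (P [set w | meeting_time R X Y w < (c * n%:R ^+ 2)%:E] <= (10 * c)%:E)%E.
Proof.
move=> c0; set r := c * _; have r0 : 0 <= r by rewrite mulr_ge0 ?exprn_ge0.
pose B t := [set w | X t w <> Y t w /\ X t.+1 w = Y t.+1 w].
have mB t : measurable (B t).
  apply: (measurableI _ _ (coupling_measurable_event t (fun x y => x <> y))).
  exact: (coupling_measurable_event t.+1 (fun x y => x = y)).
pose N := [set w | X 0%N w = Y 0%N w].
have mN : measurable N by exact: (coupling_measurable_event 0 eq).
have PN : P N = 0%E.
  apply/negligibleP => //; move: start; apply: negligibleS => w Nw /=.
  exact.
(* A first meeting at time [s.+1 < r] comes from step [s], and [s.+1 <= r] means [s < K]. *)
pose K := Num.trunc r.
have sub : [set w | (meeting_time R X Y w < r%:E)%E] `<=`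
    (\big[setU/set0]_(t < K) B t) `|` N.
  move=> w /meeting_time_lt [t tr XYt].
  have ex : exists t, X t w == Y t w by exists t; apply/eqP.
  (* Take the first meeting time: 0 puts [w] in the null set [N]; at [s.+1], minimality says that
     the walks still differ at [s]. *)
  case: (ex_minnP ex) => -[/eqP ? _|s /eqP XYs smin]; first by right.
  left; rewrite -bigcup_mkord; exists s => /=.
    rewrite truncn_gt_nat (le_trans _ (ltW tr)) // ler_nat.
    by apply: smin; apply/eqP.
  by split=> // /eqP /smin; rewrite ltnn.
apply: (@le_trans _ _ (P ((\big[setU/set0]_(t < K) B t) `|` N))).
  apply: le_measure; rewrite ?inE //; first exact: measurable_meeting_time_lt.
  by apply: measurableU => //; exact: bigsetU_measurable.
rewrite measureU0 //; last exact: bigsetU_measurable.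
apply: (le_trans (measure_finU_le _ _ (fun t : 'I_K => mB t))).
apply: (@le_trans _ _ (\sum_(t < K) (10 / (n ^ 2)%:R)%:E)%E).
  by apply: lee_sum => t _; exact: meeting_step_le.
rewrite sumEFin lee_fin sumr_const card_ord -[_ *+ K]mulr_natl.
apply: (@le_trans _ _ (r * (10 / (n ^ 2)%:R))).
  by rewrite ler_wpM2r ?divr_ge0 // truncn_le.
(* The factor [n ^ 2] cancels only for nonzero [n]; for [n = 0] the left side is 0. *)
rewrite /r natrX; have [->|n0] := eqVneq (n%:R : R) 0.
  by rewrite expr0n mulr0 mul0r mulr_ge0.
by rewrite mulrCA -mulrA divff ?expf_neq0 // mulr1.
Qed.

Lemma meeting_time_integral_ge :
  ((40^-1 * n%:R ^+ 2)%:E <= \int[P]_w meeting_time R X Y w)%E.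
Proof.
(* Markov's inequality needs a positive level, so [n = 0] is treated apart. *)
have [n0|n0] := eqVneq (n%:R : R) 0.
  rewrite n0 expr0n mulr0; apply: integral_ge0 => w _.
  exact: meeting_time_ge0.
(* At [c = 1/20] an early meeting has probability at most 1/2, so Markov's inequality at level [r]
   yields [r / 2], hence the constant 1/40. *)
pose r : R := 20^-1 * n%:R ^+ 2.
have r0 : 0 < r by rewrite mulr_gt0 // exprn_gt0 // lt0r n0 ler0n.
have mlt := measurable_meeting_time_lt r.
have := @early_meeting_le 20^-1; rewrite invr_ge0 => /(_ (ler0n R 20)) early.
have late : ((2^-1)%:E <= P (~` [set w | (meeting_time R X Y w < r%:E)%E]))%E.
  rewrite probability_setC // leeBrDr; last exact: fin_num_measure.
  apply: (le_trans (leeD2l _ early)); rewrite -EFinD lee_fin; lra.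
have := le_integral_abse P measurableT measurable_meeting_time r0.
rewrite setTI; under eq_integral do rewrite gee0_abs ?meeting_time_ge0 //.
apply: le_trans.
rewrite (_ : mkset _ = ~` [set w | (meeting_time R X Y w < r%:E)%E]); last first.
  by apply/seteqP; split => w /=;
    rewrite gee0_abs ?meeting_time_ge0 // leNgt => /negP.
apply: (@le_trans _ _ (r%:E * (2^-1)%:E)%E).
  by rewrite -EFinM lee_fin /r mulrAC -invfM -natrM.
by apply: lee_wpmul2l => //; rewrite lee_fin ltW.
Qed.

End coupling.

(** The time to meet is random, so the lower bound is given both in expectation and in probability,
    with constants uniform in [n] and in the coupling. *)
Theorem lemma8 (R : realType) :
  (exists2 c : R, 0 < c &
     forall (n : nat) (d : measure_display) (T : measurableType d)
       (P : probability T R) (X Y : nat -> T -> 'S_n),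
     markovian_coupling P X Y ->
     {ae P, forall w, X 0%N w <> Y 0%N w} ->
     ((c * n%:R ^+ 2)%:E <= \int[P]_w meeting_time R X Y w)%E) /\
  (forall eps : R, 0 < eps -> exists2 c : R, 0 < c &
     forall (n : nat) (d : measure_display) (T : measurableType d)
       (P : probability T R) (X Y : nat -> T -> 'S_n),
     markovian_coupling P X Y ->
     {ae P, forall w, X 0%N w <> Y 0%N w} ->
     (P [set w | meeting_time R X Y w < (c * n%:R ^+ 2)%:E] <= eps%:E)%E).
Proof.
split.
  by exists 40^-1 => // n d T P X Y XY; exact: meeting_time_integral_ge.
(* The early-meeting bound is [10 * c], which equals [eps] for this witness. *)
move=> eps eps0; exists (eps / 10) => [|n d T P X Y XY start].
  by rewrite divr_gt0.
have := early_meeting_le XY start (divr_ge0 (ltW eps0) (ler0n R 10)).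
by rewrite [10 * _]mulrC divfK.
Qed.
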